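(* Let $A\in\mathbb{R}^{m\times p}$ (with no zero rows), $B\in\mathbb{R}^{q\times n}$ and $C\in\mathbb{R}^{m\times n}$ be such that the matrix equation $AXB=C$ is consistent. Let $0<\alpha<\frac{2}{\|B\|^2}$ and let $X^k$ denote the $k$th iterate obtained by the maximal weighted residual block Kaczmarz (MWRBK) method (defined in the context) with $\mathrm{range}(X^0)\subseteq\mathrm{range}(A^T)$ and $\mathrm{range}((X^0)^T)\subseteq\mathrm{range}(B)$. Then, with $X_*=A^+CB^+$, $$\|X^{k+1}-X_*\|_F^2\le\prod_{\ell=0}^k\delta_{\ell,1}\cdot\|X^0-X_*\|_F^2\le\delta^{k+1}\cdot\|X^0-X_*\|_F^2,$$ where $\delta_{\ell,1}$ and $\delta$ are defined in the context.
   Context: $M_{i,:}$ denotes the $i$th row of a matrix $M$, $A_{i,:}^T$ the transpose of the $i$th row of $A$, $\|\cdot\|$ the 2-norm (spectral norm for matrices), $\|\cdot\|_F$ the Frobenius norm, $M^+$ the Moore--Penrose pseudoinverse, $\mathrm{range}(M)$ the column space, $\sigma_{\min}(M)$ the smallest singular value, $[m]=\{1,\dots,m\}$. The equation is consistent if it has at least one solution; $X_*=A^+CB^+$ is then its unique solution of minimum Frobenius norm. MWRBK method (initial guess $X^0\in\mathbb{R}^{p\times q}$, parameter $\alpha$): set $R^0=C-AX^0B$. For $k=0,1,2,\dots$: let $i_k$ be the index $i\in[m]$ maximizing $\|R^k_{i,:}\|^2/\|A_{i,:}\|^2$ (the smallest such index if there are several); update $$X^{k+1}=X^k+\tfrac{\alpha}{\|A_{i_k,:}\|^2}A_{i_k,:}^T\,(R^k_{i_k,:}B^T),\qquad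 R^{k+1}=R^k-\tfrac{\alpha}{\|A_{i_k,:}\|^2}\,(AA_{i_k,:}^T)\,(R^k_{i_k,:}B^TB),$$ so that $R^k=C-AX^kB$. Standing assumption: at each iteration $k$, the ratios $\|R^k_{i,:}\|^2/\|A_{i,:}\|^2$, $i\in[m]$, are not all equal. Define $$\Omega_k=\Big\{i:\ \tfrac{\|R^k_{i,:}\|^2}{\|A_{i,:}\|^2}<\tfrac1m\sum_{j\in[m]}\tfrac{\|R^k_{j,:}\|^2}{\|A_{j,:}\|^2}\Big\},$$ and let $\varepsilon\in(0,1)$ (depending on $k$) be defined by $\frac1m\sum_{i\in[m]}\frac{\|R^k_{i,:}\|^2}{\|A_{i,:}\|^2}=\varepsilon\cdot\max_{1\le i\le m}\frac{\|R^k_{i,:}\|^2}{\|A_{i,:}\|^2}$. Let $$\varphi_{k,1}=\frac{1}{\sum_{i\in[m]\setminus\Omega_k}\|A_{i,:}\|^2+\varepsilon\sum_{i\in\Omega_k}\|A_{i,:}\|^2},$$ $$\delta_{k,1}=1-(2\alpha-\alpha^2\|B\|^2)\,\varphi_{k,1}\,\sigma_{\min}^2(A)\,\sigma_{\min}^2(B),\qquad \delta=1-\frac{2\alpha-\alpha^2\|B\|^2}{\|A\|_F^2}\,\sigma_{\min}^2(A)\,\sigma_{\min}^2(B).$$ *)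

(* Defs.v *)
From HB Require Import structures.
From mathcomp Require Import all_boot all_order all_algebra.
From mathcomp Require Import boolp classical_sets reals.

Set Implicit Arguments.
Unset Strict Implicit.
Unset Printing Implicit Defensive.

Import Order.TTheory GRing.Theory Num.Theory.

Local Open Scope ring_scope.

(* On row and column vectors this is the Euclidean norm. *)
Definition fnorm (R : realType) (m n : nat) (M : 'M[R]_(m, n)) : R :=
  Num.sqrt (\sum_i \sum_j M i j ^+ 2).

(* The matrix norm induced by the Euclidean norm. *)
Definition norm2 (R : realType) (m n : nat) (M : 'M[R]_(m, n)) : R :=
  sup [set fnorm (M *m x) | x in [set x : 'cV[R]_n | fnorm x <= 1]]%classic.

(* The min(m, n) singular values of M are the square roots of the eigenvalues
   of the smaller of the two Gram matrices M^T M and M M^T; the larger one has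
   |m - n| additional zero eigenvalues, which are not singular values of M. *)
Definition singular_value (R : realType) (m n : nat) (M : 'M[R]_(m, n))
    (s : R) : bool :=
  (0 <= s) && (if (n <= m)%N then eigenvalue (M^T *m M) (s ^+ 2)
               else eigenvalue (M *m M^T) (s ^+ 2)).

Definition sigma_min (R : realType) (m n : nat) (M : 'M[R]_(m, n)) : R :=
  inf [set s : R | singular_value M s]%classic.

(* Inclusion of column spaces: mathcomp's %MS order compares row spaces. *)
Definition range_sub (R : realType) (m n1 n2 : nat)
    (U : 'M[R]_(m, n1)) (V : 'M[R]_(m, n2)) : bool :=
  (U^T <= V^T)%MS.

Definition penrose (R : realType) (m n : nat)
    (M : 'M[R]_(m, n)) (P : 'M[R]_(n, m)) : Prop :=
  [/\ M *m P *m M = M,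
      P *m M *m P = P,
      (M *m P)^T = M *m P &
      (P *m M)^T = P *m M].

(* [penrose_mpinv] and [penrose_unique] below show that this is the unique
   solution of the Penrose equations. It is not mathcomp's [pinvmx], which
   satisfies only some of them. *)
Definition mpinv (R : realType) (m n : nat) (M : 'M[R]_(m, n)) :
    'M[R]_(n, m) :=
  xget 0 [set P | penrose M P]%classic.

Definition consistent (R : realType) (m p q n : nat)
    (A : 'M[R]_(m, p)) (B : 'M[R]_(q, n)) (C : 'M[R]_(m, n)) : Prop :=
  exists Y : 'M[R]_(p, q), A *m Y *m B = C.

Section Method.
Variables (R : realType) (m p q n : nat).
Variables (A : 'M[R]_(m, p)) (B : 'M[R]_(q, n)).

(* In this section S : 'M_(m, n) stands for the residual C - A X B. *)

Definition row_ratio (S : 'M[R]_(m, n)) (i : 'I_m) : R :=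
  fnorm (row i S) ^+ 2 / fnorm (row i A) ^+ 2.

Definition first_argmax (S : 'M[R]_(m, n)) (i : 'I_m) : Prop :=
  (forall j : 'I_m, row_ratio S j <= row_ratio S i) /\
  (forall j : 'I_m, row_ratio S j = row_ratio S i -> (i <= j)%N).

(* X, S and idx are the iterates, the residuals and the selected rows i_k of
   the run with right-hand side C and parameter alpha started at X 0. *)
Definition mwrbk (C : 'M[R]_(m, n)) (alpha : R) (X : nat -> 'M[R]_(p, q))
    (S : nat -> 'M[R]_(m, n)) (idx : nat -> 'I_m) : Prop :=
  S 0%N = C - A *m X 0%N *m B /\
  forall k : nat,
    let a := row (idx k) A in
    let r := row (idx k) (S k) in
    [/\ first_argmax (S k) (idx k),
        X k.+1 = X k + (alpha / fnorm a ^+ 2) *: (a^T *m (r *m B^T)) &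
        S k.+1 = S k - (alpha / fnorm a ^+ 2) *:
                         ((A *m a^T) *m (r *m B^T *m B))].

Definition mean_ratio (S : 'M[R]_(m, n)) : R :=
  m%:R^-1 * \sum_(j < m) row_ratio S j.

(* The ratios are nonnegative, so 0 is a neutral starting value. *)
Definition max_ratio (S : 'M[R]_(m, n)) : R :=
  \big[Num.max/0]_(i < m) row_ratio S i.

Definition Omega (S : 'M[R]_(m, n)) : {set 'I_m} :=
  [set i : 'I_m | row_ratio S i < mean_ratio S].

(* The solution of mean_ratio S = eps * max_ratio S; if the ratios are not all
   equal then max_ratio S > 0 and eps is in (0, 1). *)
Definition eps (S : 'M[R]_(m, n)) : R := mean_ratio S / max_ratio S.

Definition phi1 (S : 'M[R]_(m, n)) : R :=
  (\sum_(i | i \notin Omega S) fnorm (row i A) ^+ 2 +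
   eps S * \sum_(i in Omega S) fnorm (row i A) ^+ 2)^-1.

Definition delta1 (alpha : R) (S : 'M[R]_(m, n)) : R :=
  1 - (2 * alpha - alpha ^+ 2 * norm2 B ^+ 2) * phi1 S *
      sigma_min A ^+ 2 * sigma_min B ^+ 2.

Definition delta (alpha : R) : R :=
  1 - (2 * alpha - alpha ^+ 2 * norm2 B ^+ 2) / fnorm A ^+ 2 *
      sigma_min A ^+ 2 * sigma_min B ^+ 2.

End Method.

Lemma penrose_unique (R : realType) (m n : nat) (M : 'M[R]_(m, n))
  (P Q : 'M[R]_(n, m)) : penrose M P -> penrose M Q -> P = Q.
Proof.
case=> p1 p2 p3 p4 [q1 q2 q3 q4].
have eMP : M *m P = M *m Q.
  rewrite -p3 -{1}q1 -(mulmxA (M *m Q)) trmx_mul p3 q3.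
  by rewrite mulmxA p1.
have ePM : P *m M = Q *m M.
  rewrite -p4 -{1}q1 -!mulmxA (mulmxA P) trmx_mul p4 q4.
  by rewrite -!mulmxA (mulmxA M) p1.
by rewrite -p2 ePM -mulmxA eMP mulmxA q2.
Qed.

Lemma gram_unitmx (R : realType) (m n : nat) (G : 'M[R]_(m, n)) :
  row_free G -> G *m G^T \in unitmx.
Proof.
move=> freeG; rewrite -row_free_unit; apply: inj_row_free => v v0.
apply: (row_free_injr freeG); rewrite /mulmxr mul0mx.
have /matrixP/(_ ord0 ord0) : (v *m G) *m (v *m G)^T = 0.
  by rewrite trmx_mul mulmxA -(mulmxA v) v0 mul0mx.
rewrite !mxE => /eqP; rewrite psumr_eq0; last first.
  by move=> j _; rewrite [X in _ * X]mxE -expr2 sqr_ge0.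
move=> /allP h; apply/rowP => j; rewrite [RHS]mxE; apply/eqP.
have := h j (mem_index_enum j).
by rewrite [X in _ * X]mxE mulf_eq0 orbb.
Qed.

Lemma penrose_mpinv (R : realType) (m n : nat) (M : 'M[R]_(m, n)) :
  penrose M (mpinv M).
Proof.
suff [P hP] : exists P, penrose M P by apply: (xgetPex 0); exists P.
have [r [F [G [M_FG uF uG]]]] : exists r (F : 'M[R]_(m, r)) (G : 'M[R]_(r, n)),
    [/\ F *m G = M, F^T *m F \in unitmx & G *m G^T \in unitmx].
  exists (\rank M), (col_base M), (row_base M).
  rewrite mulmx_base; split=> //; last exact/gram_unitmx/row_base_free.
  rewrite -[X in _ *m X]trmxK; apply: gram_unitmx.
  by rewrite /row_free mxrank_tr -/(row_full _) col_base_full.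
set L := invmx (F^T *m F) *m F^T; set K := G^T *m invmx (G *m G^T).
have LF : L *m F = 1%:M by rewrite /L -mulmxA mulVmx.
have GK : G *m K = 1%:M by rewrite /K mulmxA mulmxV.
have MP : M *m (K *m L) = F *m L.
  by rewrite -M_FG -mulmxA (mulmxA G) GK mul1mx.
have PM : (K *m L) *m M = K *m G.
  by rewrite -M_FG -mulmxA (mulmxA L) LF mul1mx.
exists (K *m L); split.
- by rewrite MP -M_FG -mulmxA (mulmxA L) LF mul1mx.
- by rewrite PM -mulmxA (mulmxA G) GK mul1mx.
- by rewrite MP /L !trmx_mul trmxK trmx_inv trmx_mul trmxK mulmxA.
- by rewrite PM /K !trmx_mul trmxK trmx_inv trmx_mul trmxK mulmxA.
Qed.

(* Main.v *)
Require Import Defs.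
From HB Require Import structures.
From mathcomp Require Import all_boot all_order all_algebra.
From mathcomp Require Import boolp classical_sets reals.
From mathcomp Require Import ring lra.

Set Implicit Arguments.
Unset Strict Implicit.
Unset Printing Implicit Defensive.

Import Order.TTheory GRing.Theory Num.Theory.

Local Open Scope ring_scope.

(** Write E_k = X_k - Xstar, so that S_k = - A E_k B by consistency, and let i
    be the row selected at step k.  The update adds to E_k a rank-one matrix
    whose inner product with E_k is - alpha |S_k,i|^2 / |A_i|^2 and whose
    squared norm is at most
    alpha^2 |B|^2 |S_k,i|^2 / |A_i|^2; expanding the square gives
      |E_(k+1)|^2 <= |E_k|^2 - (2 alpha - alpha^2 |B|^2) max_ratio S_k
    ([row_update_error]).  The greedy choice makes the decrease large.  In
      |S_k|^2 = sum_i ratio_i |A_i|^2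
    each ratio is at most the maximum, and for i in Omega_k it is below the
    mean, which is eps times the maximum; hence
    max_ratio S_k >= phi_k |S_k|^2 ([residual_le_max]).

    The error stays in the subspace of matrices A^T Y B^T
    ([mwrbk_error_range]), on which
    |A E B|^2 >= sigma_min(A)^2 sigma_min(B)^2 |E|^2 ([sigma_min_mul2]).
    Together these give the one-step contraction by the factor delta1
    ([mwrbk_contraction]).  Iterating it requires delta1 >= 0: since the
    ratios differ, S_k and thus E_k is nonzero, and the contraction of a
    positive quantity to a nonnegative one has a nonnegative factor
    ([delta1_ge0]).  The second inequality is the comparison of phi_k with
    1 / |A|_F^2, factor by factor.

    The bound by sigma_min rests on one spectral fact: the infimum l of the
    Rayleigh quotient of a positive semidefinite matrix G is an eigenvalue
    ([rayleigh_min]).  Compactness of the sphere and diagonalization are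
    avoided by the observation that G - l I, were it invertible, would be
    bounded below by a positive multiple of the identity
    ([rayleigh_unit]), contradicting the choice of l. *)

(** * The Frobenius inner product *)

Definition fdot (R : realType) (m n : nat) (U V : 'M[R]_(m, n)) : R :=
  \tr (U^T *m V).

Section FrobeniusProduct.
Variable R : realType.
Implicit Types m n p : nat.

Lemma fdotE m n (U V : 'M[R]_(m, n)) :
  fdot U V = \sum_i \sum_j U i j * V i j.
Proof.
rewrite /fdot /mxtrace exchange_big /=; apply: eq_bigr => j _.
by rewrite mxE; apply: eq_bigr => i _; rewrite mxE.
Qed.

Lemma fdotC m n (U V : 'M[R]_(m, n)) : fdot U V = fdot V U.
Proof. by rewrite /fdot -mxtrace_tr trmx_mul trmxK. Qed.

Lemma fdotDl m n (U V W : 'M[R]_(m, n)) : fdot (U + V) W = fdot U W + fdot V W.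
Proof. by rewrite /fdot linearD /= mulmxDl mxtraceD. Qed.

Lemma fdotZl m n c (U V : 'M[R]_(m, n)) : fdot (c *: U) V = c * fdot U V.
Proof. by rewrite /fdot linearZ /= -scalemxAl mxtraceZ. Qed.

Lemma fdot0 m n (V : 'M[R]_(m, n)) : fdot 0 V = 0.
Proof. by rewrite /fdot trmx0 mul0mx mxtrace0. Qed.

Lemma fdotDr m n (U V W : 'M[R]_(m, n)) : fdot U (V + W) = fdot U V + fdot U W.
Proof. by rewrite fdotC fdotDl !(fdotC U). Qed.

Lemma fdotZr m n c (U V : 'M[R]_(m, n)) : fdot U (c *: V) = c * fdot U V.
Proof. by rewrite fdotC fdotZl fdotC. Qed.

Lemma fdot_mull m n p (M : 'M[R]_(m, n)) (U : 'M_(n, p)) (V : 'M_(m, p)) :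
  fdot (M *m U) V = fdot U (M^T *m V).
Proof. by rewrite /fdot trmx_mul mulmxA. Qed.

Lemma fdot_mulr m n p (M : 'M[R]_(n, p)) (U : 'M_(m, n)) (V : 'M_(m, p)) :
  fdot (U *m M) V = fdot U (V *m M^T).
Proof. by rewrite /fdot trmx_mul -mulmxA mxtrace_mulC mulmxA. Qed.

Lemma fdot_ge0 m n (U : 'M[R]_(m, n)) : 0 <= fdot U U.
Proof.
by rewrite fdotE; do 2!apply: sumr_ge0 => ? _; rewrite -expr2 sqr_ge0.
Qed.

Lemma fdot_eq0 m n (U : 'M[R]_(m, n)) : fdot U U = 0 -> U = 0.
Proof.
rewrite fdotE => /eqP; rewrite psumr_eq0 => [/allP h|i _]; last first.
  by apply: sumr_ge0 => ? _; rewrite -expr2 sqr_ge0.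
apply/matrixP => i j; rewrite mxE; apply/eqP.
have := h i (mem_index_enum i); rewrite /= psumr_eq0 => [/allP h'|? _].
  by have := h' j (mem_index_enum j); rewrite /= mulf_eq0 orbb.
by rewrite -expr2 sqr_ge0.
Qed.

Lemma fdot_gt0 m n (U : 'M[R]_(m, n)) : U != 0 -> 0 < fdot U U.
Proof.
by move=> U0; rewrite lt_def fdot_ge0 andbT; apply: contra_neq U0 => /fdot_eq0.
Qed.

Lemma fnorm_ge0 m n (U : 'M[R]_(m, n)) : 0 <= fnorm U.
Proof. exact: sqrtr_ge0. Qed.

Lemma fnorm_sqr m n (U : 'M[R]_(m, n)) : fnorm U ^+ 2 = fdot U U.
Proof.
rewrite /fnorm fdotE sqr_sqrtr.
  by apply: eq_bigr => i _; apply: eq_bigr => j _; rewrite expr2.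
by do 2!apply: sumr_ge0 => ? _; rewrite sqr_ge0.
Qed.

Lemma fdot_tr m n (U V : 'M[R]_(m, n)) : fdot U^T V^T = fdot U V.
Proof. by rewrite /fdot trmxK mxtrace_mulC -/(fdot V U) fdotC. Qed.

Lemma fdot_rows m n (U V : 'M[R]_(m, n)) :
  fdot U V = \sum_i fdot (row i U) (row i V).
Proof.
rewrite fdotE; apply: eq_bigr => i _; rewrite fdotE big_ord1.
by apply: eq_bigr => j _; rewrite !mxE.
Qed.

(** The quadratic t |-> <U + t V, H (U + t V)> is nonnegative, so its
    discriminant is nonpositive. *)
Lemma psd_cauchy_schwarz m n (H : 'M[R]_m) (U V : 'M[R]_(m, n)) :
  H^T = H -> (forall Z : 'M[R]_(m, n), 0 <= fdot Z (H *m Z)) ->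
  fdot U (H *m V) ^+ 2 <= fdot U (H *m U) * fdot V (H *m V).
Proof.
move=> Hsym Hpsd.
set c := fdot U (H *m V); set a := fdot U _; set b := fdot V _.
have quad t : 0 <= a + 2 * t * c + t ^+ 2 * b.
  have := Hpsd (U + t *: V).
  rewrite mulmxDr -scalemxAr !(fdotDl, fdotDr, fdotZl, fdotZr) -/a -/b -/c.
  have -> : fdot V (H *m U) = c by rewrite fdotC fdot_mull Hsym.
  by congr (_ <= _); ring.
have b_ge0 : 0 <= b by exact: Hpsd.
have [b0|b_neq0] := eqVneq b 0.
  have [->|c0] := eqVneq c 0; first by rewrite b0 mulr0 expr0n.
  (* With b = 0 the quadratic is affine; at this t it takes the value -1. *)
  have := quad (- (a + 1) / (2 * c)); rewrite b0 mulr0 addr0.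
  have -> : a + 2 * (- (a + 1) / (2 * c)) * c = -1 by field.
  by rewrite oppr_ge0 leNgt ltr01.
have b_gt0 : 0 < b by rewrite lt_def b_neq0.
(* The minimum of the quadratic is attained here. *)
have := quad (- c / b).
have -> : a + 2 * (- c / b) * c + (- c / b) ^+ 2 * b = (a * b - c ^+ 2) / b.
  by field.
by rewrite pmulr_lge0 ?invr_gt0 // subr_ge0.
Qed.

Lemma fdot_cauchy_schwarz m n (U V : 'M[R]_(m, n)) :
  fdot U V ^+ 2 <= fdot U U * fdot V V.
Proof.
have := @psd_cauchy_schwarz m n 1%:M U V; rewrite !mul1mx trmx1; apply => // Z.
by rewrite mul1mx fdot_ge0.
Qed.

(** Cauchy-Schwarz applied to each entry of the product.  Besides serving as
    an operator norm estimate, it shows that the supremum defining [norm2] is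
    over a bounded set. *)
Lemma fdot_mul_le m n p (M : 'M[R]_(m, n)) (U : 'M[R]_(n, p)) :
  fdot (M *m U) (M *m U) <= fdot M M * fdot U U.
Proof.
rewrite (fdot_rows M) -(fdot_tr U) (fdot_rows U^T) mulr_suml fdotE.
apply: ler_sum => i _; rewrite mulr_sumr; apply: ler_sum => j _.
rewrite -expr2.
have -> : (M *m U) i j = fdot (row i M) (row j U^T).
  by rewrite fdotE big_ord1 mxE; apply: eq_bigr => k _; rewrite !mxE.
exact: fdot_cauchy_schwarz.
Qed.

Lemma mulmx_col_le_norm2 m n (M : 'M[R]_(m, n)) (x : 'cV[R]_n) :
  fdot (M *m x) (M *m x) <= norm2 M ^+ 2 * fdot x x.
Proof.
have [->|x0] := eqVneq x 0.
  by rewrite mulmx0 !fdot0 mulr0.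
have x_gt0 : 0 < fnorm x.
  by rewrite lt_def fnorm_ge0 andbT -sqrf_eq0 fnorm_sqr gt_eqF ?fdot_gt0.
have ub : fnorm (M *m ((fnorm x)^-1 *: x)) <= norm2 M.
  apply: ub_le_sup.
    exists (fnorm M) => _ [y /= y1 <-].
    rewrite -(@ler_pXn2r _ 2) ?nnegrE ?fnorm_ge0 // !fnorm_sqr.
    apply: le_trans (fdot_mul_le M y) _.
    by rewrite ler_piMr ?fdot_ge0 // -fnorm_sqr expr_le1 // fnorm_ge0.
  exists ((fnorm x)^-1 *: x) => //=.
  rewrite -(@ler_pXn2r _ 2) ?nnegrE ?fnorm_ge0 // fnorm_sqr fdotZl fdotZr.
  by rewrite -fnorm_sqr expr1n mulrA -expr2 exprVn mulVf // sqrf_eq0 gt_eqF.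
have : fnorm (M *m ((fnorm x)^-1 *: x)) ^+ 2 <= norm2 M ^+ 2.
  by rewrite lerXn2r // nnegrE ?fnorm_ge0 // (le_trans _ ub) ?fnorm_ge0.
rewrite fnorm_sqr -scalemxAr fdotZl fdotZr mulrA -expr2 exprVn fnorm_sqr.
by rewrite mulrC ler_pdivrMr // fdot_gt0.
Qed.

End FrobeniusProduct.

(** * Rayleigh quotients and the smallest singular value *)

Section Rayleigh.
Variable R : realType.

(** Put Y = H^-1 Z.  Cauchy-Schwarz for the form of H gives
    |Z|^4 = <Z, H Y>^2 <= <Z, H Z> <Y, Z>, and <Y, Z> <= K |Z|^2 because H^-1
    is bounded. *)
Lemma rayleigh_unit (n k : nat) (H : 'M[R]_n) :
  H^T = H -> (forall Z : 'M[R]_(n, k), 0 <= fdot Z (H *m Z)) -> H \in unitmx ->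
  exists2 c, 0 < c & forall Z : 'M[R]_(n, k), c * fdot Z Z <= fdot Z (H *m Z).
Proof.
move=> Hsym Hpsd Hunit; set K := fnorm (invmx H) + 1.
(* The summand 1 makes K positive also in dimension 0. *)
have K_gt0 : 0 < K by rewrite ltr_wpDl ?fnorm_ge0.
exists K^-1 => [|Z]; first by rewrite invr_gt0.
have [->|Z0] := eqVneq Z 0; first by rewrite !fdot0 mulr0.
rewrite ler_pdivrMl //; set Y := invmx H *m Z.
have HY : H *m Y = Z by rewrite mulmxA mulmxV // mul1mx.
have z_gt0 := fdot_gt0 Z0.
have YZ : fdot Y Z <= K * fdot Z Z.
  rewrite (le_trans (ler_norm _)) // -(@ler_pXn2r _ 2) ?nnegrE ?normr_ge0
    ?mulr_ge0 ?fdot_ge0 ?(ltW K_gt0) //.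
  rewrite real_normK ?num_real //; apply: le_trans (fdot_cauchy_schwarz _ _) _.
  rewrite exprMn (expr2 (fdot Z Z)) mulrA ler_wpM2r ?fdot_ge0 //.
  apply: le_trans (fdot_mul_le _ _) _; rewrite ler_wpM2r ?fdot_ge0 //.
  rewrite -fnorm_sqr lerXn2r ?nnegrE ?fnorm_ge0 ?(ltW K_gt0) //.
  by rewrite /K lerDl ler01.
have := psd_cauchy_schwarz Z Y Hsym Hpsd; rewrite HY => CS.
rewrite -(ler_pM2r z_gt0) -expr2 (le_trans CS) //.
by rewrite (mulrC K) -mulrA ler_wpM2l.
Qed.

(** The infimum of the Rayleigh quotient is an eigenvalue: otherwise the
    positive semidefinite matrix G - inf would be invertible, and
    [rayleigh_unit] would provide a strictly larger lower bound.  The quotient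
    is taken over matrices with k columns, so that the estimates below hold
    for the Frobenius norm without splitting into columns. *)
Lemma rayleigh_min (n k : nat) (G : 'M[R]_n) (Z0 : 'M[R]_(n, k)) : Z0 != 0 ->
  G^T = G -> (forall Z : 'M[R]_(n, k), 0 <= fdot Z (G *m Z)) ->
  exists l, [/\ 0 <= l, eigenvalue G l &
    forall Z : 'M[R]_(n, k), l * fdot Z Z <= fdot Z (G *m Z)].
Proof.
move=> Z0_neq0 Gsym Gpsd.
pose Q := [set fdot Z (G *m Z) / fdot Z Z
  | Z in [set Z : 'M[R]_(n, k) | Z != 0]]%classic.
have Qlb : lbound Q 0 by move=> _ [Z _ <-]; rewrite divr_ge0 ?fdot_ge0.
have Qne : (Q !=set0)%classic by exists (fdot Z0 (G *m Z0) / fdot Z0 Z0), Z0.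
have Qinf (Z : 'M[R]_(n, k)) : inf Q * fdot Z Z <= fdot Z (G *m Z).
  have [->|Zn0] := eqVneq Z 0; first by rewrite !fdot0 mulr0.
  by rewrite -ler_pdivlMr ?fdot_gt0 //; apply: ge_inf; [exists 0 | exists Z].
exists (inf Q); split => //; first exact: lb_le_inf.
have subE (Z : 'M[R]_(n, k)) :
    fdot Z ((G - (inf Q)%:M) *m Z) = fdot Z (G *m Z) - inf Q * fdot Z Z.
  by rewrite mulmxBl mul_scalar_mx -scaleNr fdotDr fdotZr mulNr.
rewrite /eigenvalue /eigenspace kermx_eq0 row_free_unit.
apply/negP => /rayleigh_unit -/(_ k) [||c c_gt0 hc].
- by rewrite linearB /= tr_scalar_mx Gsym.
- by move=> Z; rewrite subE subr_ge0.
have : inf Q + c <= inf Q.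
  apply: lb_le_inf => // _ [Z /= Zn0 <-].
  by rewrite ler_pdivlMr ?fdot_gt0 // mulrDl -lerBrDl -subE.
by rewrite gerDl leNgt c_gt0.
Qed.

(** Matrices without singular values (a dimension being 0) are covered by the
    convention that the infimum of the empty set is 0. *)
Lemma sigma_min_ge0 (m n : nat) (M : 'M[R]_(m, n)) : 0 <= sigma_min M.
Proof.
rewrite /sigma_min; set s := (X in inf X).
have [->|/set0P sn0] := eqVneq s set0; first by rewrite inf0.
by apply: lb_le_inf => // x /andP[].
Qed.

Lemma sigma_min_le (m n : nat) (M : 'M[R]_(m, n)) (s : R) :
  singular_value M s -> sigma_min M <= s.
Proof.
by move=> Ms; apply: ge_inf => //; exists 0 => x /andP[].
Qed.

(** The number s is only required to be a lower bound of the square roots of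
    the eigenvalues, so that the lemma applies with N = M or N = M^T,
    whichever Gram matrix defines the singular values of M. *)
Lemma gram_rayleigh (m n k : nat) (N : 'M[R]_(m, n)) (s : R) : 0 <= s ->
  (forall t, 0 <= t -> eigenvalue (N^T *m N) (t ^+ 2) -> s <= t) ->
  forall Z : 'M[R]_(n, k), s ^+ 2 * fdot Z Z <= fdot (N *m Z) (N *m Z).
Proof.
move=> s_ge0 s_min Z.
have [->|Zn0] := eqVneq Z 0; first by rewrite mulmx0 !fdot0 mulr0.
have [|W|l [l_ge0 l_ev l_min]] := @rayleigh_min _ _ (N^T *m N) Z Zn0.
- by rewrite trmx_mul trmxK.
- by rewrite -mulmxA -fdot_mull fdot_ge0.
have sl : s ^+ 2 <= l.
  rewrite -[l]sqr_sqrtr // lerXn2r ?nnegrE ?sqrtr_ge0 //.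
  by apply: s_min; rewrite ?sqrtr_ge0 ?sqr_sqrtr.
rewrite fdot_mull mulmxA (le_trans _ (l_min Z)) //.
by rewrite ler_wpM2r ?fdot_ge0.
Qed.

(** A lower bound for N on its whole domain passes to N^T on the range of N:
    |N Z|^4 = <Z, N^T N Z>^2 <= |Z|^2 |N^T N Z|^2, while
    c |Z|^2 <= |N Z|^2. *)
Lemma gram_rayleigh_range (m n k : nat) (N : 'M[R]_(m, n)) (c : R) :
  (forall Z : 'M[R]_(n, k), c * fdot Z Z <= fdot (N *m Z) (N *m Z)) ->
  forall Z : 'M[R]_(n, k),
    c * fdot (N *m Z) (N *m Z) <= fdot (N^T *m (N *m Z)) (N^T *m (N *m Z)).
Proof.
move=> hN Z; set W := N^T *m (N *m Z).
have [->|Zn0] := eqVneq Z 0.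
  by rewrite mulmx0 fdot0 mulr0 fdot_ge0.
have NZ : fdot (N *m Z) (N *m Z) = fdot Z W by rewrite fdot_mull.
rewrite -(ler_pM2l (fdot_gt0 Zn0)) (le_trans _ (fdot_cauchy_schwarz _ _)) //.
by rewrite mulrA (mulrC _ c) -NZ expr2 ler_wpM2r ?fdot_ge0.
Qed.

(** A tall M satisfies the bound on its whole domain.  A wide one has a kernel,
    and there it is M^T that satisfies the bound on its whole domain, which
    [gram_rayleigh_range] transfers to M on the range of M^T. *)
Lemma sigma_min_row_space (m n k : nat) (M : 'M[R]_(m, n)) (Z : 'M[R]_(n, k)) :
  range_sub Z M^T -> sigma_min M ^+ 2 * fdot Z Z <= fdot (M *m Z) (M *m Z).
Proof.
rewrite /range_sub trmxK => /submxP[D ZE].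
have {D ZE} [Y ->] : exists Y, Z = M^T *m Y.
  by exists D^T; rewrite -[LHS]trmxK ZE trmx_mul.
have s0 := sigma_min_ge0 M.
have [mn|mn] := leqP n m.
  apply: gram_rayleigh => // t t0 ev; apply: sigma_min_le.
  by rewrite /singular_value t0 mn.
suff MT_ge (W : 'M[R]_(m, k)) :
    sigma_min M ^+ 2 * fdot W W <= fdot (M^T *m W) (M^T *m W).
  by have := gram_rayleigh_range MT_ge Y; rewrite trmxK.
apply: gram_rayleigh => // t t0; rewrite trmxK => ev; apply: sigma_min_le.
by rewrite /singular_value t0 leqNgt mn.
Qed.

(** This is not [sigma_min_row_space] for M^T: a square matrix and its
    transpose have singular values defined through different Gram
    matrices. *)
Lemma sigma_min_col_space (m n k : nat) (M : 'M[R]_(m, n)) (Z : 'M[R]_(m, k)) :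
  range_sub Z M -> sigma_min M ^+ 2 * fdot Z Z <= fdot (M^T *m Z) (M^T *m Z).
Proof.
move=> /submxP[D ZE].
have {D ZE} [Y ->] : exists Y, Z = M *m Y.
  by exists D^T; rewrite -[LHS]trmxK ZE trmx_mul !trmxK.
have s0 := sigma_min_ge0 M.
have [mn|mn] := leqP n m.
  apply: gram_rayleigh_range; apply: gram_rayleigh => // t t0 ev.
  apply: sigma_min_le.
  by rewrite /singular_value t0 mn.
apply: gram_rayleigh => // t t0; rewrite trmxK => ev; apply: sigma_min_le.
by rewrite /singular_value t0 leqNgt mn.
Qed.

Lemma sigma_min_mul2 (m p q n : nat) (A : 'M[R]_(m, p)) (B : 'M[R]_(q, n))
    (E : 'M[R]_(p, q)) : range_sub E A^T -> range_sub E^T B ->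
  sigma_min A ^+ 2 * sigma_min B ^+ 2 * fdot E E
    <= fdot (A *m E *m B) (A *m E *m B).
Proof.
move=> EA EB; rewrite -mulmxA.
apply: (@le_trans _ _ (sigma_min A ^+ 2 * fdot (E *m B) (E *m B))); last first.
  apply: sigma_min_row_space; rewrite /range_sub trmx_mul.
  exact: submx_trans (submxMl _ _) EA.
rewrite -mulrA ler_wpM2l ?sqr_ge0 //.
rewrite -(fdot_tr E) -(fdot_tr (E *m B)) trmx_mul.
exact: sigma_min_col_space.
Qed.

End Rayleigh.

(** * The greedy choice of a row *)

Section GreedyRow.
Variables (R : realType) (m p n : nat) (A : 'M[R]_(m, p)) (S : 'M[R]_(m, n)).
Hypothesis A_row : forall i : 'I_m, row i A != 0.

Lemma fnorm_row_gt0 i : 0 < fnorm (row i A) ^+ 2.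
Proof. by rewrite fnorm_sqr fdot_gt0. Qed.

Lemma row_ratio_ge0 i : 0 <= row_ratio A S i.
Proof. by rewrite divr_ge0 ?sqr_ge0. Qed.

Lemma row_ratioK i :
  row_ratio A S i * fnorm (row i A) ^+ 2 = fnorm (row i S) ^+ 2.
Proof. by rewrite divfK // gt_eqF ?fnorm_row_gt0. Qed.

Lemma row_ratio_le_max i : row_ratio A S i <= max_ratio A S.
Proof. exact: le_bigmax. Qed.

Lemma max_ratio_argmax i :
  first_argmax A S i -> max_ratio A S = row_ratio A S i.
Proof.
case=> imax _; apply/le_anti; rewrite row_ratio_le_max andbT.
by apply: bigmax_le; first exact: row_ratio_ge0.
Qed.

Lemma mean_ratio_le_max : (0 < m)%N -> mean_ratio A S <= max_ratio A S.
Proof.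
move=> m_gt0; rewrite /mean_ratio ler_pdivrMl ?ltr0n //.
apply: le_trans (_ : \sum_(j < m) max_ratio A S <= _).
  by apply: ler_sum => i _; apply: row_ratio_le_max.
by rewrite sumr_const card_ord mulr_natl.
Qed.

Hypothesis ratios_neq : exists i j : 'I_m, row_ratio A S i <> row_ratio A S j.

Lemma max_ratio_gt0 : 0 < max_ratio A S.
Proof.
have [i [j ij]] := ratios_neq.
rewrite lt_def (le_trans (row_ratio_ge0 i)) ?row_ratio_le_max // andbT.
apply/eqP => max0; apply: ij.
have ratio0 k : row_ratio A S k = 0.
  by apply/le_anti; rewrite row_ratio_ge0 -max0 row_ratio_le_max.
by rewrite !ratio0.
Qed.

Lemma residual_neq0 : S != 0.
Proof.
apply/eqP => S0; have [i [j []]] := ratios_neq.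
have row0 k : row_ratio A S k = 0.
  by rewrite /row_ratio S0 linear0 fnorm_sqr fdot0 mul0r.
by rewrite !row0.
Qed.

(** In |S|^2 = sum_i ratio_i |A_i|^2, bound the ratio by the maximum outside
    Omega and by the mean, eps times the maximum, inside; the resulting weight
    of the maximum is the denominator of [phi1]. *)
Lemma residual_le_max : fdot S S <= max_ratio A S / phi1 A S.
Proof.
rewrite /phi1 invrK mulrDr mulrA /eps mulrCA divff ?mulr1; last first.
  by rewrite gt_eqF ?max_ratio_gt0.
rewrite !mulr_sumr fdot_rows (bigID (fun i => i \notin Omega A S)) /=.
apply: lerD.
  apply: ler_sum => i _; rewrite -fnorm_sqr -row_ratioK.
  by rewrite ler_wpM2r ?sqr_ge0 ?row_ratio_le_max.
rewrite [leLHS](eq_bigl (fun i => i \in Omega A S)) => [|i]; last first.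
  by rewrite negbK.
apply: ler_sum => i; rewrite /= !inE => i_mean.
by rewrite -fnorm_sqr -row_ratioK ler_wpM2r ?sqr_ge0 ?ltW.
Qed.

(** The denominator of [phi1] cannot vanish, because by [residual_le_max] it
    bounds the nonzero residual. *)
Lemma phi1_gt0 : 0 < phi1 A S.
Proof.
have := lt_le_trans (fdot_gt0 residual_neq0) residual_le_max.
by rewrite pmulr_rgt0 ?max_ratio_gt0 // invr_gt0.
Qed.

(** Since eps <= 1, the denominator of [phi1] is at most
    sum_i |A_i|^2 = |A|_F^2. *)
Lemma phi1_ge : (fnorm A ^+ 2)^-1 <= phi1 A S.
Proof.
have [i _] := ratios_neq.
have m_gt0 : (0 < m)%N by exact: leq_ltn_trans (ltn_ord i).
have le_DA : (phi1 A S)^-1 <= fnorm A ^+ 2.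
  rewrite /phi1 invrK fnorm_sqr fdot_rows.
  rewrite [leRHS](bigID (fun i => i \notin Omega A S)) /=; apply: lerD.
    by apply: ler_sum => j _; rewrite fnorm_sqr.
  rewrite mulr_sumr [leRHS](eq_bigl (mem (Omega A S))) => [|j]; last first.
    by rewrite negbK.
  apply: ler_sum => j _; rewrite -fnorm_sqr ler_piMl ?sqr_ge0 //.
  by rewrite /eps ler_pdivrMr ?max_ratio_gt0 // mul1r mean_ratio_le_max.
have D_gt0 : 0 < (phi1 A S)^-1 by rewrite invr_gt0 phi1_gt0.
by rewrite -[leRHS]invrK lef_pV2 // posrE ?(lt_le_trans D_gt0).
Qed.

End GreedyRow.

(** * One step of the iteration *)

Section Step.
Variables (R : realType) (m p q n : nat).
Variables (A : 'M[R]_(m, p)) (B : 'M[R]_(q, n)) (alpha : R).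
Hypothesis alpha_range : 0 < alpha < 2 / norm2 B ^+ 2.

(** The range of alpha forces |B| > 0, as its upper end would otherwise
    be 2 / 0 = 0. *)
Lemma gain_ge0 : 0 <= 2 * alpha - alpha ^+ 2 * norm2 B ^+ 2.
Proof.
have /andP[a_gt0 a_lt] := alpha_range.
have N_gt0 : 0 < norm2 B ^+ 2.
  rewrite lt_def sqr_ge0 andbT; apply/eqP => N0.
  by move: (lt_trans a_gt0 a_lt); rewrite N0 invr0 mulr0 ltxx.
rewrite ltr_pdivlMr // in a_lt.
have -> : 2 * alpha - alpha ^+ 2 * norm2 B ^+ 2
    = alpha * (2 - alpha * norm2 B ^+ 2).
  by ring.
by rewrite mulr_ge0 ?ltW // subr_gt0.
Qed.

(** Let U be the unscaled update a^T (r B^T), with a the selected row of A and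
    r that of the residual.  Moving the factors of U across the inner product
    gives <E, U> = <a E B, r> = - |r|^2, and |U|^2 <= |a|^2 |B|^2 |r|^2 by
    the definition of the spectral norm. *)
Lemma row_update_error (E : 'M[R]_(p, q)) (T : 'M[R]_(m, n)) (i : 'I_m) :
  row i A != 0 -> T = - (A *m E *m B) ->
  let E' := E + (alpha / fnorm (row i A) ^+ 2) *:
                  ((row i A)^T *m (row i T *m B^T)) in
  fdot E' E' <=
    fdot E E - (2 * alpha - alpha ^+ 2 * norm2 B ^+ 2) * row_ratio A T i.
Proof.
move=> ai0 TE /=; rewrite /row_ratio.
set a := row i A; set r := row i T; set U := a^T *m _.
have a_gt0 : 0 < fdot a a by rewrite fdot_gt0.
have rE : r = - (a *m E *m B) by rewrite /r /a TE linearN /= !row_mul.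
have EU : fdot E U = - fdot r r.
  rewrite fdotC /U fdot_mull trmxK fdot_mulr trmxK.
  by rewrite -[a *m E *m B]opprK -rE -scaleN1r fdotZr mulN1r.
have UU : fdot U U <= fdot a a * (norm2 B ^+ 2 * fdot r r).
  apply: le_trans (fdot_mul_le _ _) _; rewrite fdot_tr ler_wpM2l ?fdot_ge0 //.
  by rewrite -(fdot_tr (r *m _)) trmx_mul trmxK -(fdot_tr r) mulmx_col_le_norm2.
rewrite !(fdotDl, fdotDr, fdotZl, fdotZr) (fdotC U E) EU !fnorm_sqr.
set u := fdot U U in UU *; set N := norm2 B ^+ 2 in UU *.
have : (alpha / fdot a a) ^+ 2 * u
    <= (alpha / fdot a a) ^+ 2 * (fdot a a * (N * fdot r r)).
  by rewrite ler_wpM2l ?sqr_ge0.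
have -> : (alpha / fdot a a) ^+ 2 * (fdot a a * (N * fdot r r))
    = alpha ^+ 2 * N * (fdot r r / fdot a a).
  by field; rewrite gt_eqF.
set c := alpha / fdot a a => le_cu.
have -> : fdot E E + c * - fdot r r + (c * - fdot r r + c * (c * u))
    = fdot E E - 2 * alpha * (fdot r r / fdot a a) + c ^+ 2 * u.
  by rewrite /c; ring.
by move: le_cu; rewrite mulrBl; lra.
Qed.

End Step.

(** * The minimum norm solution *)

Lemma mpinv_solution (R : realType) (m p q n : nat)
    (A : 'M[R]_(m, p)) (B : 'M[R]_(q, n)) (C : 'M[R]_(m, n)) :
  consistent A B C -> A *m (mpinv A *m C *m mpinv B) *m B = C.
Proof.
case=> Y <-.
have [A1 _ _ _] := penrose_mpinv A; have [B1 _ _ _] := penrose_mpinv B.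
by rewrite !mulmxA A1 -!mulmxA (mulmxA B) B1.
Qed.

(** With P = M^+, the symmetry of P M gives
    P = P M P = M^T P^T P, whose columns lie in the range of M^T. *)
Lemma mpinv_tr_sub (R : realType) (m n : nat) (M : 'M[R]_(m, n)) :
  ((mpinv M)^T <= M)%MS.
Proof.
have [_ P2 _ P4] := penrose_mpinv M.
by rewrite -{1}P2 trmx_mul P4 mulmxA submxMl.
Qed.

(** Dually, the symmetry of M P gives P = P M P = P P^T M^T. *)
Lemma mpinv_sub_tr (R : realType) (m n : nat) (M : 'M[R]_(m, n)) :
  (mpinv M <= M^T)%MS.
Proof.
have [_ P2 P3 _] := penrose_mpinv M.
by rewrite -{1}P2 -mulmxA -P3 trmx_mul mulmxA submxMl.
Qed.

(** * The iteration *)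

Section Run.
Variables (R : realType) (m p q n : nat).
Variables (A : 'M[R]_(m, p)) (B : 'M[R]_(q, n)) (C : 'M[R]_(m, n)) (alpha : R).
Variables (X : nat -> 'M[R]_(p, q)) (S : nat -> 'M[R]_(m, n)).
Variable idx : nat -> 'I_m.
Hypothesis A_row : forall i : 'I_m, row i A != 0.
Hypothesis ABC : consistent A B C.
Hypothesis run : mwrbk A B C alpha X S idx.

Let Xstar := mpinv A *m C *m mpinv B.

Lemma mwrbk_residual k : S k = - (A *m (X k - Xstar) *m B).
Proof.
have SE : S k = C - A *m X k *m B.
  have [S0 rec] := run; elim: k => [|k IH]; first exact: S0.
  have [_ -> ->] := rec k; rewrite IH mulmxDr mulmxDl opprD addrA.
  congr (_ - _).
  by rewrite -!(scalemxAl, scalemxAr) !mulmxA.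
by rewrite SE mulmxBr mulmxBl mpinv_solution // opprB.
Qed.

(** Both the initial guess and Xstar have the form A^T Y B^T, and every update
    has its columns spanned by a row of A and its rows in the row space of
    B^T. *)
Lemma mwrbk_error_range k :
  range_sub (X 0%N) A^T -> range_sub (X 0%N)^T B ->
  range_sub (X k - Xstar) A^T /\ range_sub (X k - Xstar)^T B.
Proof.
rewrite /range_sub !trmxK => X0A X0B.
have [XA XB] : ((X k)^T <= A)%MS /\ (X k <= B^T)%MS.
  have [_ rec] := run; elim: k => [//|k [IHA IHB]]; have [_ -> _] := rec k.
  rewrite linearD /= linearZ /= trmx_mul trmxK !addmx_sub ?scalemx_sub //.
    by rewrite !mulmxA submxMl.
  by rewrite (submx_trans (submxMl _ _)) ?row_sub.
rewrite linearB /= !addmx_sub // eqmx_opp.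
  by rewrite (submx_trans (submxMl _ _)) ?mpinv_sub_tr.
by rewrite /Xstar -mulmxA trmx_mul (submx_trans (submxMl _ _)) ?mpinv_tr_sub.
Qed.

Hypothesis alpha_range : 0 < alpha < 2 / norm2 B ^+ 2.
Hypothesis X0A : range_sub (X 0%N) A^T.
Hypothesis X0B : range_sub (X 0%N)^T B.
Hypothesis ratios_neq : forall k, exists i j : 'I_m,
  row_ratio A (S k) i <> row_ratio A (S k) j.

(** The decrease in [row_update_error] is a multiple of the maximal ratio,
    which is at least phi1 |S_k|^2 with S_k = - A E_k B, hence at least
    phi1 sigma_min(A)^2 sigma_min(B)^2 |E_k|^2. *)
Lemma mwrbk_contraction k :
  fdot (X k.+1 - Xstar) (X k.+1 - Xstar)
    <= delta1 A B alpha (S k) * fdot (X k - Xstar) (X k - Xstar).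
Proof.
have [_ /(_ k) /= [imax XE _]] := run.
have -> : X k.+1 - Xstar = (X k - Xstar) + (X k.+1 - X k).
  by rewrite [RHS]addrC subrKA.
rewrite XE (addrC (X k) (_ *: _)) addrK.
apply: le_trans (row_update_error alpha (A_row _) (mwrbk_residual k)) _.
rewrite -(max_ratio_argmax imax).
have := gain_ge0 alpha_range; rewrite /delta1; set g := _ - _ => g_ge0.
rewrite (mulrBl _ 1) mul1r lerD2l lerN2 -!mulrA ler_wpM2l //.
have [EA EB] := mwrbk_error_range k X0A X0B.
have SE : fdot (S k) (S k)
    = fdot (A *m (X k - Xstar) *m B) (A *m (X k - Xstar) *m B).
  by rewrite mwrbk_residual -scaleN1r fdotZl fdotZr !mulN1r opprK.
have := residual_le_max A_row (ratios_neq k).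
rewrite ler_pdivlMr ?phi1_gt0 // mulrC => S_max; apply: le_trans S_max.
rewrite ler_pM2l ?phi1_gt0 // SE.
by have := sigma_min_mul2 EA EB; rewrite -!mulrA.
Qed.

(** A nonzero residual means a nonzero error, and a factor bounding the ratio
    of a nonnegative number to a positive one is nonnegative. *)
Lemma delta1_ge0 k : 0 <= delta1 A B alpha (S k).
Proof.
have E_gt0 : 0 < fdot (X k - Xstar) (X k - Xstar).
  apply: fdot_gt0; apply: contra_neq (residual_neq0 (ratios_neq k)) => E0.
  by rewrite mwrbk_residual -/Xstar E0 mulmx0 mul0mx oppr0.
rewrite -(pmulr_lge0 _ E_gt0); apply: le_trans (mwrbk_contraction k).
exact: fdot_ge0.
Qed.

Lemma delta1_le k : delta1 A B alpha (S k) <= delta A B alpha.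
Proof.
rewrite /delta1 /delta lerD2l lerN2 !ler_wpM2r ?sqr_ge0 //.
by rewrite ler_wpM2l ?gain_ge0 // phi1_ge.
Qed.

End Run.

Theorem theorem4p4 (R : realType) (m p q n : nat)
  (A : 'M[R]_(m, p)) (B : 'M[R]_(q, n)) (C : 'M[R]_(m, n)) (alpha : R)
  (X : nat -> 'M[R]_(p, q)) (S : nat -> 'M[R]_(m, n)) (idx : nat -> 'I_m)
  (hA : forall i : 'I_m, row i A != 0)
  (hC : consistent A B C)
  (halpha : 0 < alpha < 2 / norm2 B ^+ 2)
  (hrun : mwrbk A B C alpha X S idx)
  (hX0 : range_sub (X 0%N) A^T)
  (hX0T : range_sub (X 0%N)^T B)
  (hratio : forall k : nat, exists i j : 'I_m,
     row_ratio A (S k) i <> row_ratio A (S k) j) :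
  let Xstar := mpinv A *m C *m mpinv B in
  forall k : nat,
    fnorm (X k.+1 - Xstar) ^+ 2 <=
      (\prod_(l < k.+1) delta1 A B alpha (S l)) * fnorm (X 0%N - Xstar) ^+ 2 /\
    (\prod_(l < k.+1) delta1 A B alpha (S l)) * fnorm (X 0%N - Xstar) ^+ 2 <=
      delta A B alpha ^+ k.+1 * fnorm (X 0%N - Xstar) ^+ 2.
Proof.
move=> Xstar k; rewrite !fnorm_sqr; split; last first.
  rewrite ler_wpM2r ?fdot_ge0 // -[X in _ ^+ X]card_ord -prodr_const.
  apply: ler_prod => l _; rewrite (delta1_ge0 hA hC hrun) //=.
  exact: delta1_le.
elim: k => [|k IH].
  by rewrite big_ord1; apply: mwrbk_contraction hrun _ _ _ _ _.
rewrite big_ord_recr /= mulrAC [leRHS]mulrC.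
apply: le_trans (mwrbk_contraction hA hC hrun halpha hX0 hX0T hratio k.+1) _.
by rewrite ler_wpM2l // (delta1_ge0 hA hC hrun).
Qed.
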